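(* Assume GCH. Suppose that for every Whitehead group $A$ of infinite rank there is a Whitehead group $H_A$ of cardinality $\leq |A|^{+}$ such that $\operatorname{Ext}(H_A,A)\neq 0$. Then for every Whitehead group $B$ there is an uncountable Whitehead group $G$ such that every homomorphism from $G$ to $B$ has finitely generated range.
   Context: All groups are abelian. $\operatorname{Ext}$ means $\operatorname{Ext}^1_{\mathbb{Z}}$. A group $A$ is a Whitehead group if $\operatorname{Ext}(A,\mathbb{Z})=0$. $|A|^{+}$ denotes the successor cardinal of $|A|$. The background theory is ZFC. *)

(* Defs.v *)
From HB Require Import structures.
From mathcomp Require Import all_boot all_order all_algebra.
From mathcomp Require Import boolp classical_sets functions cardinality.

Set Implicit Arguments.
Unset Strict Implicit.
Unset Printing Implicit Defensive.

Import GRing.Theory.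
Local Open Scope classical_set_scope.
Local Open Scope card_scope.
Local Open Scope ring_scope.

(* Abelian groups are zmodTypes. Their choiceType structure is no restriction:
   classically every type carries one. *)

(* Ext^1_Z(A, C) is the set of equivalence classes of short exact sequences
   0 -> C -> E -> A -> 0, with the class of the split sequence as its zero.
   Only the vanishing of Ext is used, so the Baer sum is not constructed. *)
Record extension (A C : zmodType) := Extension {
  ext_mid :> zmodType;
  ext_in : {additive C -> ext_mid};
  ext_out : {additive ext_mid -> A};
  ext_in_inj : injective ext_in;
  ext_exact : range ext_in = [set x | ext_out x = 0];
  ext_out_surj : range ext_out = setT }.

Definition ext_equiv (A C : zmodType) (E E' : extension A C) : Prop :=
  exists f : {additive E -> E'}, [/\ bijective f,
    forall c, f (ext_in E c) = ext_in E' c &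
    forall x, ext_out E' (f x) = ext_out E x].

Lemma ext_equiv_refl (A C : zmodType) (E : extension A C) : ext_equiv E E.
Proof. by exists idfun; split => //; exists id. Qed.

Lemma ext_equiv_sym (A C : zmodType) (E E' : extension A C) :
  ext_equiv E E' -> ext_equiv E' E.
Proof.
move=> [f [[g fK gK] fi fo]].
have gB : zmod_morphism g.
  by move=> x y; apply: (can_inj fK); rewrite raddfB !gK.
pose g' : {additive E' -> E} :=
  HB.pack g (GRing.isZmodMorphism.Build E' E g gB).
exists g'; split; first by exists f.
- by move=> c; rewrite -fi /= fK.
- by move=> x; rewrite -fo /= gK.
Qed.

Lemma ext_equiv_trans (A C : zmodType) (E1 E2 E3 : extension A C) :
  ext_equiv E1 E2 -> ext_equiv E2 E3 -> ext_equiv E1 E3.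
Proof.
move=> [f [fb fi fo]] [g [gb gi go]].
exists (g \o f); split; first exact: bij_comp.
- by move=> c /=; rewrite fi gi.
- by move=> x /=; rewrite go fo.
Qed.

Section SplitExtension.
Variables A C : zmodType.

Definition split_in (c : C) : (C * A)%type := (c, 0).

Fact split_in_is_zmod_morphism : zmod_morphism split_in.
Proof. by move=> x y; congr pair; rewrite /= subr0. Qed.

HB.instance Definition _ :=
  GRing.isZmodMorphism.Build C (C * A)%type split_in split_in_is_zmod_morphism.

Fact split_in_inj : injective split_in.
Proof. by move=> x y []. Qed.

Fact split_exact : range split_in = [set x | x.2 = 0].
Proof.
apply/seteqP; split => [_ [c _ <-] //|[c a] /= ->].
by exists c.
Qed.

Fact split_out_surj : range (@snd C A) = setT.
Proof. by apply/seteqP; split => // a _; exists (0, a). Qed.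

Definition split_extension : extension A C :=
  @Extension A C _ split_in (@snd C A) split_in_inj split_exact split_out_surj.

End SplitExtension.

Definition Ext (A C : zmodType) :=
  {X : extension A C -> Prop | exists E, X = ext_equiv E}.

Definition Ext_zero (A C : zmodType) : Ext A C :=
  exist _ (ext_equiv (split_extension A C)) (ex_intro _ _ erefl).

Definition Ext_eq0 (A C : zmodType) : Prop := forall X : Ext A C, X = Ext_zero A C.

Definition Whitehead (A : zmodType) : Prop := Ext_eq0 A int.

Definition Z_independent (A : zmodType) (S : set A) : Prop :=
  forall (s : seq A) (c : A -> int), uniq s -> [set` s] `<=` S ->
    \sum_(x <- s) x *~ c x = 0 -> forall x, x \in s -> c x = 0.

Definition max_Z_independent (A : zmodType) (S : set A) : Prop :=
  Z_independent S /\ forall S', Z_independent S' -> S `<=` S' -> S' = S.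

(* The rank of A is the common cardinality of its maximal independent subsets. *)
Definition infinite_rank (A : zmodType) : Prop :=
  exists2 S : set A, max_Z_independent S & infinite_set S.

Definition card_lt (T U : Type) : Prop :=
  [set: T] #<= [set: U] /\ ~ ([set: U] #<= [set: T]).

(* S has cardinality |T|^+, the least cardinal above |T|. *)
Definition is_card_succ (T S : Type) : Prop :=
  card_lt T S /\ forall U : Type, card_lt T U -> [set: S] #<= [set: U].

Definition GCH : Prop :=
  forall T : Type, infinite_set [set: T] -> is_card_succ T (set T).

Definition card_le_succ (H A : Type) : Prop :=
  exists2 S : Type, is_card_succ A S & [set: H] #<= [set: S].

Definition finitely_generated_set (B : zmodType) (X : set B) : Prop :=
  exists (n : nat) (g : 'I_n -> B),
    X = [set \sum_(i < n) g i *~ c i | c in [set: 'I_n -> int]].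

(* Main.v *)
From HB Require Import structures.
Require Import Defs.
From mathcomp Require Import all_boot all_order all_algebra.
From mathcomp Require Import boolp classical_sets functions cardinality.
From mathcomp Require Import ring.

(** The group G is the union of a tower of groups that destroys, one after
    the other, the homomorphisms to B with a range of infinite rank.

    Let X be a group of the tower and f : X -> B a homomorphism whose range A
    has infinite rank. A is a subgroup of the Whitehead group B, hence a
    Whitehead group, and by hypothesis there is a Whitehead group H with
    Ext(H, A) nonzero. Since Ext^2 vanishes, Ext(H, X) -> Ext(H, A) is onto, so
    some extension Y of X by H becomes nonsplit when it is pushed out along f;
    this says that f has no extension Y -> A ([nonsplit_lift]). At every stage,
    such an extension is made for all f at once. All the quotients that occur
    are Whitehead groups, and so is the union G ([Whitehead_filtration]).

    Let now f : G -> B have range A. The stages are indexed by well-founded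
    trees that branch over a set containing B, so the stages at which the
    elements of A first appear as values have a common upper bound, and A is
    already the range of the restriction of f to one stage X. If A had infinite
    rank, f would extend this restriction with values in A, which the tower
    prevents ([union_hom]). So A has finite rank. Being a Whitehead group, it
    is then finitely generated ([Whitehead_finite_rank]). The group G is
    uncountable because there are uncountably many trees
    ([tree_uncountable]) and each stage contributes a new element.

    Ext is handled through Q/Z: from 0 -> Z -> Q -> Q/Z -> 0, a group is
    Whitehead exactly when its homomorphisms to Q/Z lift to Q
    ([Whitehead_lift]). A homomorphism to a quotient D/P of a divisible group
    is represented by a function to D that is additive up to P, and the
    injectivity of D/P is [divisible_extension]. Extensions need no
    quotients either: the tower lives in a rational vector space V, and an
    extension of X by H is the subgroup generated by X and the vectors
    c(h) + e(h), where e embeds H in new coordinates and c : H -> V is additive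
    up to X. *)

Set Implicit Arguments.
Unset Strict Implicit.
Unset Printing Implicit Defensive.

Import GRing.Theory Num.Theory.

Local Open Scope classical_set_scope.
Local Open Scope ring_scope.

(** * Subgroups and divisible groups *)

Definition subgroup (V : zmodType) (P : set V) : Prop :=
  P 0 /\ forall x y, P x -> P y -> P (x - y).

Record subgroup_type (V : zmodType) (S : zmodClosed V) :=
  SubgroupElt { subgroup_val :> V; _ : subgroup_val \in S }.

HB.instance Definition _ (V : zmodType) (S : zmodClosed V) :=
  [isSub for @subgroup_val V S].
HB.instance Definition _ (V : zmodType) (S : zmodClosed V) :=
  [Choice of subgroup_type S by <:].
HB.instance Definition _ (V : zmodType) (S : zmodClosed V) :=
  [SubChoice_isSubZmodule of subgroup_type S by <:].

Lemma subgroup_as_group (V : zmodType) (P : set V) : subgroup P ->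
  exists (U : zmodType) (i : {additive U -> V}), injective i /\ range i = P.
Proof.
move=> [P0 PB]; pose p : pred V := fun x => `[< P x >].
have pC : zmod_closed p.
  split=> [|x y /asboolP Px /asboolP Py]; apply/asboolP => //; exact: PB.
pose S : zmodClosed V := HB.pack p (GRing.isZmodClosed.Build V p pC).
exists (subgroup_type S), \val; split; first exact: val_inj.
apply/seteqP; split=> [_ [[x xS] _ <-]|x Px]; first exact/asboolP.
have xS : x \in S by apply/asboolP.
by exists (SubgroupElt xS).
Qed.

Lemma subgroupN (V : zmodType) (P : set V) x : subgroup P -> P x -> P (- x).
Proof. by move=> [P0 PB] Px; rewrite -sub0r; apply: PB. Qed.

Lemma subgroupD (V : zmodType) (P : set V) x y :
  subgroup P -> P x -> P y -> P (x + y).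
Proof. by move=> sP Px Py; rewrite -[y]opprK; apply: sP.2 => //; apply: subgroupN. Qed.

Lemma subgroupMz (V : zmodType) (P : set V) x n :
  subgroup P -> P x -> P (x *~ n).
Proof.
move=> sP Px; have Pn k : P (x *+ k).
  by elim: k => [|k IH]; [exact: sP.1 | rewrite mulrS; apply: subgroupD].
by case: n => k; [exact: Pn | rewrite NegzE mulrNz; apply: subgroupN => //; exact: Pn].
Qed.

Lemma range_subgroup (U V : zmodType) (f : {additive U -> V}) : subgroup (range f).
Proof.
split; first by exists 0; rewrite ?raddf0.
by move=> _ _ [x _ <-] [y _ <-]; exists (x - y); rewrite ?raddfB.
Qed.

(** Only nonempty chains are considered, since the union of the empty chain is
    not a subgroup. *)
Lemma Zorn_above (T : Type) (P : set (set T)) (A0 : set T) : P A0 ->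
    (forall F : set (set T), F `<=` P -> F !=set0 -> total_on F subset ->
      P (\bigcup_(X in F) X)) ->
  exists A, [/\ P A, A0 `<=` A & forall B, P B -> A `<=` B -> B = A].
Proof.
move=> PA0 Pcup; pose Q A := P (A0 `|` A).
have [F FQ totF|A [QA maxA]] := @Zorn_bigcup T Q.
- have [[X0 FX0]|/set0P/negP/negPn/eqP ->] := pselect (F !=set0); last first.
    by rewrite /Q bigcup_set0 setU0.
  have -> : Q (\bigcup_(X in F) X) =
      P (\bigcup_(Y in [set A0 `|` X | X in F]) Y).
    congr P; apply/seteqP; split=> [x [A0x|[X FX Xx]]|x [_ [X FX <-] [A0x|Xx]]].
    + by exists (A0 `|` X0); [exists X0 | left].
    + by exists (A0 `|` X); [exists X | right].
    + by left.
    + by right; exists X.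
  apply: Pcup.
  + by move=> _ [X FX <-]; apply: FQ.
  + by exists (A0 `|` X0), X0.
  + move=> _ _ [X FX <-] [Y FY <-].
    by have [XY|YX] := totF _ _ FX FY; [left|right]; apply: setUS.
- exists (A0 `|` A); split=> [//|x|B PB AB]; first by left.
  apply/seteqP; split=> // x Bx; apply: contrapT => nx.
  have A0B : A0 `|` B = B by apply/setUidr => y A0y; apply: AB; left.
  apply: (maxA B); last by rewrite /Q A0B.
  split; first by move=> y Ay; apply: AB; right.
  by move=> BA; apply: nx; right; apply: BA.
Qed.

Lemma subrACA (V : zmodType) (a b c d : V) : (a - b) - (c - d) = (a - c) - (b - d).
Proof. by rewrite !opprB [d - c]addrC addrACA [- b + d]addrC. Qed.

Definition divisible (D : zmodType) : Prop :=
  forall (d : D) n, (0 < n)%N -> exists d', d' *+ n = d.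

Lemma int_multiples (I : set int) : subgroup I ->
  exists m : nat, (I m%:Z) /\ forall n, I n -> exists q, n = q * m%:Z.
Proof.
move=> sI; have [[n0 [In0 n0_gt0]]|no] :=
  pselect (exists n : nat, I n%:Z /\ (0 < n)%N); last first.
  exists 0%N; split; [exact: sI.1 | move=> n In; exists 0; rewrite mul0r].
  apply: contrapT => n_neq0; apply: no; exists `|n|%N.
  split; last by rewrite absz_gt0; apply/eqP.
  case: n In {n_neq0} => k // Ik.
  by have := subgroupN sI Ik; rewrite NegzE opprK.
have exn : exists n : nat, `[< I n%:Z /\ (0 < n)%N >] by exists n0; apply/asboolP.
case: (ex_minnP exn) => m /asboolP[Im m_gt0] minm; exists m; split=> // n In.
exists (n %/ m)%Z; rewrite {1}(divz_eq n m); apply/eqP.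
rewrite -subr_eq0 [X in X - _]addrC addrK; apply: contraT => r_neq0.
have Ir : I (n %% m)%Z.
  have -> : (n %% m)%Z = n - m%:Z *~ (n %/ m)%Z.
    by rewrite mulrzz mulrC {2}(divz_eq n m) addrC addKr.
  by apply: sI.2 => //; apply: subgroupMz.
have m_neq0 : m%:Z != 0 by rewrite eqz_nat -lt0n.
have := modz_ge0 n m_neq0; have := ltz_pmod n (m_gt0 : 0 < m%:Z).
case: (n %% m)%Z Ir r_neq0 => // k Ik k_neq0 km _.
have /minm : `[< I k%:Z /\ (0 < k)%N >].
  by apply/asboolP; split=> //; rewrite lt0n.
by rewrite leqNgt -ltz_nat km.
Qed.

Lemma pairB (V D : zmodType) (x y : V) (d e : D) : (x, d) - (y, e) = (x - y, d - e).
Proof. by []. Qed.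

Lemma pairMz (V D : zmodType) (x : V) (d : D) n : (x, d) *~ n = (x *~ n, d *~ n).
Proof.
have pairMn k : (x, d) *+ k = (x *+ k, d *+ k).
  by elim: k => // k IH; rewrite !mulrS IH.
by case: n => n; [exact: pairMn | rewrite -[LHS]/(- ((x, d) *+ n.+1)) pairMn].
Qed.

(** Baer's criterion in a form that covers every quotient of D at once. The
    relation R is a partial homomorphism from V to D/P, where P is the fiber
    of R over 0; it extends to V because D/P is divisible. A maximal relation
    with the same fiber P is total: a vector k is adjoined with a value d
    such that m d is the prescribed value at the least positive multiple m k
    of k in the domain. *)
Lemma divisible_extension (V D : zmodType) (R : set (V * D)) :
    divisible D -> subgroup R ->
  exists c : V -> D, (forall x y, R (0, c (x - y) - (c x - c y))) /\
    forall x d, R (x, d) -> R (0, d - c x).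
Proof.
move=> divD sR.
pose P (S : set (V * D)) := subgroup S /\ forall d, S (0, d) -> R (0, d).
have [|F FP [S0 FS0] totF|S [[sS S0R] RS maxS]] := @Zorn_above _ P R.
- by split.
- split; last by move=> d [S FS Sd]; apply: (FP _ FS).2.
  split; first by exists S0 => //; exact: (FP _ FS0).1.1.
  move=> x y [S1 FS1 S1x] [S2 FS2 S2y].
  have [S12|S21] := totF _ _ FS1 FS2.
    by exists S2 => //; apply: (FP _ FS2).1.2 => //; apply: S12.
  by exists S1 => //; apply: (FP _ FS1).1.2 => //; apply: S21.
have totS k : exists d, S (k, d).
  pose I n := exists d, S (k *~ n, d).
  have sI : subgroup I.
    split; first by exists 0; rewrite mulr0z; exact: sS.1.
    move=> m n [d Sd] [e Se]; exists (d - e).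
    by rewrite mulrzBr; apply: (sS.2 _ _ Sd Se).
  have [m [[e Se] mI]] := int_multiples sI.
  have [d0 Sd0] : exists d0, S (k *~ m%:Z, d0 *~ m%:Z).
    case: m Se mI => [|m] Se mI; first by exists 0; rewrite !mulr0z; exact: sS.1.
    by have [d0 d0e] := divD e m.+1 isT; exists d0; rewrite -[d0 *~ _]/(d0 *+ m.+1) d0e.
  (* d0 is a compatible value at k; it is arbitrary when no multiple of k is in
     the domain. *)
  pose S' := [set p : V * D | exists n, S (p - (k, d0) *~ n)].
  have S'S : S' = S.
    apply: maxS; last by move=> p Sp; exists 0; rewrite mulr0z subr0.
    split.
      split; first by exists 0; rewrite mulr0z subr0; exact: sS.1.
      move=> p q [n Sn] [l Sl]; exists (n - l).
      by rewrite mulrzBr subrACA; apply: sS.2.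
    move=> d [n Sn]; apply: S0R.
    have {}Sn : S (k *~ - n, d - d0 *~ n).
      by rewrite pairMz in Sn; rewrite mulrNz -[- (k *~ n)]sub0r; exact: Sn.
    have [|q nE] := mI (- n); first by exists (d - d0 *~ n).
    have Sq : S (k *~ - n, d0 *~ - n).
      by rewrite nE mulrC !mulrzA -pairMz; apply: subgroupMz.
    have := sS.2 _ _ Sn Sq.
    by rewrite pairB subrr mulrNz opprK subrK.
  exists d0; rewrite -S'S; exists 1; rewrite mulr1z subrr; exact: sS.1.
have [c Sc] := choice totS.
exists c; split=> [x y|x d Rxd]; apply: S0R.
  have := sS.2 _ _ (Sc (x - y)) (sS.2 _ _ (Sc x) (Sc y)).
  by rewrite !pairB subrr.
have := sS.2 _ _ (RS _ Rxd) (Sc x).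
by rewrite pairB subrr.
Qed.

(** * Ext and the lifting of characters *)

Lemma additiveP (U V : zmodType) (f : U -> V) : zmod_morphism f ->
  exists g : {additive U -> V}, g =1 f.
Proof.
move=> fB; pose g : {additive U -> V} := HB.pack f (GRing.isZmodMorphism.Build U V f fB).
by exists g.
Qed.

(** A section s of E gives the isomorphism (c, a) |-> c + s a from the split
    extension onto E, and conversely. *)
Lemma Ext_eq0_section (A C : zmodType) : Ext_eq0 A C <->
  forall E : extension A C, exists s : {additive A -> E}, cancel s (ext_out E).
Proof.
split=> [Ext0 E|sec [X [E XE]]].
  have EE : ext_equiv E = ext_equiv (split_extension A C).
    exact: (congr1 sval (Ext0 (exist _ (ext_equiv E) (ex_intro _ _ erefl)))).
  have /ext_equiv_sym[f [_ _ fo]] : ext_equiv E (split_extension A C).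
    by rewrite EE; exact: ext_equiv_refl.
  have [|s sE] := @additiveP A E (fun x => f (0, x)).
    by move=> x y; rewrite -raddfB pairB subrr.
  by exists s => x; rewrite sE fo.
have [s sK] := sec E.
pose f0 (p : split_extension A C) : E := ext_in E p.1 + s p.2.
have [f fE] : exists f : {additive split_extension A C -> E}, f =1 f0.
  apply: additiveP => p q.
  by rewrite /f0 /= !raddfB /= opprD addrACA.
have fo p : ext_out E (f p) = p.2.
  rewrite fE /f0 raddfD sK.
  have : range (ext_in E) (ext_in E p.1) by exists p.1.
  by rewrite ext_exact /= => ->; rewrite add0r.
have f_inj : injective f.
  apply: raddf_inj => -[c a] fp0.
  have a0 : a = 0 by have := fo (c, a); rewrite fp0 raddf0.
  move: fp0; rewrite a0 fE /f0 /= raddf0 addr0 => c0; congr (_, _).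
  by apply: (@ext_in_inj _ _ E); rewrite c0 raddf0.
have f_surj x : exists p, f p = x.
  have : range (ext_in E) (x - s (ext_out E x)).
    by rewrite ext_exact /= raddfB sK subrr.
  by case=> c _ cE; exists (c, ext_out E x); rewrite fE /f0 /= cE subrK.
have [g gK] := choice f_surj.
have Ef : ext_equiv (split_extension A C) E.
  exists f; split=> //; first by exists g => //; apply: inj_can_sym.
  by move=> c; rewrite fE /f0 /= raddf0 addr0.
apply: eq_exist => /=; rewrite XE; apply/funext => E'; apply/propext.
by split=> [EE'|]; [apply: ext_equiv_trans EE'|apply: ext_equiv_trans (ext_equiv_sym Ef)].
Qed.

(** A homomorphism from A to Q/Z, given by representatives in Q. *)
Definition circle_character (A : zmodType) (c : A -> rat) : Prop :=
  forall x y, c (x - y) - (c x - c y) \is a Num.int.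

Lemma circle_character0 (A : zmodType) (c : A -> rat) :
  circle_character c -> c 0 \is a Num.int.
Proof. by move/(_ 0 0); rewrite !subrr subr0. Qed.

Lemma divisible_rat : divisible rat.
Proof.
move=> d n n_gt0; exists (d / n%:R); rewrite -[LHS]mulr_natr divfK //.
by rewrite pnatr_eq0 -lt0n.
Qed.

Lemma int_eq0 (z : int) : z%:~R = 0 :> rat -> z = 0.
Proof. by move/eqP; rewrite intr_eq0 => /eqP. Qed.

(** The exact sequence Hom(A, Q) -> Hom(A, Q/Z) -> Ext(A, Z) -> 0 at the level
    of elements. A character c of A yields the pull-back of Q -> Q/Z along c, an
    extension of A by Z whose sections are the lifts of c. Conversely, the
    inclusion of Z in Q extends to the middle term of any extension of A by Z,
    and induces there a character of A; a lift of this character corrects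
    any set-theoretic section to an additive one. *)
Lemma Whitehead_lift (A : zmodType) : Whitehead A <->
  forall c : A -> rat, circle_character c ->
    exists g : {additive A -> rat}, forall x, g x - c x \is a Num.int.
Proof.
rewrite /Whitehead; split=> [/Ext_eq0_section sec c cc|lift].
  have c0 := circle_character0 cc.
  have [|U [i [i_inj iE]]] :=
      @subgroup_as_group (rat * A)%type [set p | p.1 - c p.2 \is a Num.int].
    split=> [|p q /= pI qI]; first by rewrite /= sub0r rpredN.
    have -> : (p - q).1 - c (p - q).2 = (p.1 - c p.2) - (q.1 - c q.2)
        - (c (p.2 - q.2) - (c p.2 - c q.2)).
      by rewrite (subrACA p.1) (subrACA (p.1 - q.1)) subrr subr0.
    by apply: rpredB; [exact: rpredB | exact: cc].
  have iP p : p.1 - c p.2 \is a Num.int -> exists u, i u = p.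
    move=> pI; have : range i p by rewrite iE.
    by case=> u _ <-; exists u.
  have i_int u : (i u).1 - c (i u).2 \is a Num.int.
    have : range i (i u) by exists u.
    by rewrite iE.
  have /choice[j0 j0E] (z : int) : exists u, i u = (z%:~R, 0).
    by apply: iP; apply: rpredB => //; exact: intr_int.
  have [|j jE] := @additiveP _ _ j0.
    by move=> x y; apply: i_inj; rewrite raddfB !j0E pairB subrr rmorphB.
  have ijE z : i (j z) = (z%:~R, 0) by rewrite jE j0E.
  have j_inj : injective j.
    apply: raddf_inj => z jz0; apply: int_eq0.
    by have := ijE z; rewrite jz0 raddf0 => -[<-].
  have jex : range j = [set x | (snd \o i) x = 0].
    apply/seteqP; split=> [_ [z _ <-]|u /= u0]; first by rewrite /= ijE.
    have := i_int u; rewrite u0 => uI.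
    have /intrP[z zE] : (i u).1 \is a Num.int by rewrite -(subrK (c 0) (_.1)) rpredD.
    by exists z => //; apply: i_inj; rewrite ijE -zE -u0 -surjective_pairing.
  have jsurj : range (snd \o i) = setT.
    apply/seteqP; split=> // x _; have [|u uE] := iP (c x, x).
      by rewrite /= subrr.
    by exists u => //=; rewrite uE.
  have [s sK] := sec (Extension j_inj jex jsurj).
  exists (fst \o (i \o s)) => x /=.
  by have := i_int (s x); have /= -> := sK x.
apply/Ext_eq0_section => E.
have [||r [rB0 rin0]] := @divisible_extension E rat [set p | exists z, p = (ext_in E z, z%:~R)].
- exact: divisible_rat.
- split; first by exists 0; rewrite raddf0.
  by move=> _ _ [x ->] [y ->]; exists (x - y); rewrite pairB raddfB rmorphB.
have R0 q : [set p | exists z, p = (ext_in E z, z%:~R)] (0, q) -> q = 0.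
  case=> z [z0 ->]; suff -> : z = 0 by [].
  by apply: (@ext_in_inj _ _ E); rewrite -z0 raddf0.
have rB : zmod_morphism r by move=> x y; apply/eqP; rewrite -subr_eq0; apply/eqP/R0.
have rin z : r (ext_in E z) = z%:~R.
  by apply/esym/eqP; rewrite -subr_eq0; apply/eqP/R0/rin0; exists z.
have [r' r'E] := additiveP rB.
have kerE x : ext_out E x = 0 -> exists z, ext_in E z = x.
  move=> x0; have : range (ext_in E) x by rewrite ext_exact.
  by case=> z _ <-; exists z.
have /choice[e eK] a : exists x, ext_out E x = a.
  have : range (ext_out E) a by rewrite ext_out_surj.
  by case=> x _ <-; exists x.
have [|g gI] := lift (fun a => r (e a)).
  move=> x y; rewrite -!rB.
  have [|z <-] := kerE (e (x - y) - (e x - e y)).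
    by rewrite 2!raddfB !eK subrr.
  by rewrite rin.
have /choice[z zE] a : exists z : int, g a - r (e a) = z%:~R by apply/intrP/gI.
pose s a := e a + ext_in E (z a).
have inK w : ext_out E (ext_in E w) = 0.
  have : range (ext_in E) (ext_in E w) by exists w.
  by rewrite ext_exact.
have sK a : ext_out E (s a) = a by rewrite raddfD eK inK addr0.
have rs a : r (s a) = g a.
  by rewrite -r'E raddfD !r'E rin -zE addrC subrK.
have [|s' s'E] := @additiveP _ _ s; last by exists s' => a; rewrite s'E.
move=> x y; apply/eqP; rewrite -subr_eq0; apply/eqP.
have [|w wE] := kerE (s (x - y) - (s x - s y)).
  by rewrite 2!raddfB !sK subrr.
rewrite -wE; suff -> : w = 0 by rewrite raddf0.
by apply: int_eq0; rewrite -rin wE !rB !rs raddfB subrr.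
Qed.

(** * Extending and separating characters *)

Lemma subgroup0 (V : zmodType) : subgroup [set (0 : V)].
Proof. by split=> // x y /= -> ->; rewrite subrr. Qed.

Lemma extend_circle_character (A : zmodType) (R : set (A * rat)) : subgroup R ->
    (forall q, R (0, q) -> q \is a Num.int) ->
  exists2 c : A -> rat, circle_character c &
    forall x q, R (x, q) -> q - c x \is a Num.int.
Proof.
move=> sR R0; have [c [cB cR]] := divisible_extension divisible_rat sR.
by exists c => [x y|x q Rxq]; apply: R0; [exact: cB | exact: cR].
Qed.

(** Characters extend from U to V because Q/Z is injective. *)
Lemma Whitehead_subgroup (U V : zmodType) (i : {additive U -> V}) :
  injective i -> Whitehead V -> Whitehead U.
Proof.
move=> i_inj /Whitehead_lift lift; apply/Whitehead_lift => c cc.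
pose R := [set p | exists u q, p = (i u, q) /\ q - c u \is a Num.int].
have [||r rc rR] := @extend_circle_character V R.
- split.
    exists 0, 0; rewrite raddf0; split=> //.
    by rewrite sub0r rpredN circle_character0.
  move=> _ _ [u [p [-> pI]]] [v [q [-> qI]]]; exists (u - v), (p - q).
  split; first by rewrite pairB raddfB.
  have -> : p - q - c (u - v) = (p - c u) - (q - c v)
      - (c (u - v) - (c u - c v)).
    by rewrite (subrACA p) (subrACA (p - q)) subrr subr0.
  by apply: rpredB; [exact: rpredB | exact: cc].
- move=> q [u [p [[/esym u0 ->]]]].
  have -> : u = 0 by apply: i_inj; rewrite u0 raddf0.
  by move=> pI; rewrite -(subrK (c 0) p) rpredD // circle_character0.
have [g gI] := lift r rc; exists (g \o i) => u /=.
have ru : c u - r (i u) \is a Num.int.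
  by apply: rR; exists u, (c u); rewrite subrr.
rewrite -[_ - _](subrKA (r (i u))) rpredD //.
by rewrite -opprB rpredN.
Qed.

Lemma unit_fraction_not_int n : (1 < n)%N -> (n%:R^-1 : rat) \isn't a Num.int.
Proof.
move=> n_gt1; apply/negP => /intrP[z zE].
have n_neq0 : (n%:R : rat) != 0 by rewrite pnatr_eq0; case: n n_gt1 {zE}.
have /eqP : (1 : rat) = (z * n%:Z)%:~R by rewrite intrM -zE mulVf.
rewrite -[1]/(1%:~R) eqr_int => /eqP E.
by have := dvdz_mull z (dvdzz n%:Z); rewrite -E dvdzE /= dvdn1 => /eqP n1; rewrite n1 in n_gt1.
Qed.

(** Q/Z is a cogenerator: the character of Z a + C that vanishes on C and sends
    a to 1/n is well defined when n is the order of a modulo C, or any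
    integer, here 2, if this order is infinite. *)
Lemma separating_character (A : zmodType) (C : set A) (a : A) :
    subgroup C -> ~ C a ->
  exists t : A -> rat, [/\ circle_character t,
    forall x, C x -> t x \is a Num.int & t a \isn't a Num.int].
Proof.
move=> sC nCa; have [|m [Im mI]] := @int_multiples [set k | C (a *~ k)].
  split; first by rewrite /= mulr0z; exact: sC.1.
  by move=> k l /= Ck Cl; rewrite mulrzBr; apply: sC.2.
pose n := if m == 0%N then 2%N else m.
have n_gt1 : (1 < n)%N.
  rewrite /n; case: m Im {mI n} => [|[|m]] C1 //.
pose t : rat := n%:R^-1.
have kt k : C (a *~ k) -> k%:~R * t \is a Num.int.
  move=> /mI[q ->]; rewrite /t /n; case: eqP => [->|/eqP m_neq0].
    by rewrite mulr0 mul0r.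
  by rewrite intrM -mulrA mulfV ?mulr1 ?pnatr_eq0 ?intr_int.
pose R := [set p : A * rat | exists k : int,
  C (p.1 - a *~ k) /\ p.2 - k%:~R * t \is a Num.int].
have [||c cc cR] := @extend_circle_character A R.
- split.
    by exists 0; rewrite mulr0z mul0r !subr0; split=> //; exact: sC.1.
  move=> p q [k [Ck kI]] [l [Cl lI]]; exists (k - l); split.
    by rewrite mulrzBr subrACA; apply: sC.2.
  by rewrite rmorphB mulrBl subrACA rpredB.
- move=> q [k [/= Ck qk]]; rewrite -(subrK (k%:~R * t) q) rpredD // kt //.
  by rewrite sub0r in Ck; rewrite -[a *~ k]opprK; apply: subgroupN.
exists c; split=> // [x Cx|].
  have := cR x 0; rewrite sub0r rpredN; apply; exists 0.
  by rewrite mulr0z mul0r !subr0.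
apply/negP => caI; move/negP: (unit_fraction_not_int n_gt1); apply.
rewrite -/t -(subrK (c a) t) rpredD // cR //; exists 1.
by rewrite mulr1z mul1r !subrr; split=> //; exact: sC.1.
Qed.

(** Lift to Q a character that does not vanish at h. Whitehead groups are
    therefore torsion-free and embed in rational vector spaces. *)
Lemma Whitehead_separated (H : zmodType) (h : H) : Whitehead H -> h <> 0 ->
  exists x : {additive H -> rat}, x h <> 0.
Proof.
move=> /Whitehead_lift lift h_neq0.
have [t [tc _ th]] := separating_character (@subgroup0 H) h_neq0.
have [g gI] := lift t tc; exists g => gh0.
by move/negP: th; apply; have := gI h; rewrite gh0 sub0r rpredN.
Qed.

Definition span (V : zmodType) (X : set V) : set V :=
  [set v | forall P, subgroup P -> X `<=` P -> P v].

Lemma span_subgroup (V : zmodType) (X : set V) : subgroup (span X).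
Proof.
split=> [P [P0 _] //|x y Xx Xy P sP XP].
by apply: sP.2; [exact: Xx | exact: Xy].
Qed.

Lemma sub_span (V : zmodType) (X : set V) : X `<=` span X.
Proof. by move=> x Xx P _; apply. Qed.

Lemma span_min (V : zmodType) (X P : set V) : subgroup P -> X `<=` P -> span X `<=` P.
Proof. by move=> sP XP v; apply. Qed.

(** Otherwise a could be added to S. *)
Lemma torsion_mod_max_independent (A : zmodType) (S : set A) :
    max_Z_independent S ->
  forall a, exists2 m : int, m <> 0 & span S (a *~ m).
Proof.
move=> [indS maxS] a; apply: contrapT => noM.
have aS : ~ S a by move=> Sa; apply: noM; exists 1 => //; exact: sub_span.
apply: aS; rewrite -(maxS (a |` S)); [by left| |by move=> x; right].
move=> s c us sS sum0.
have sSp := span_subgroup S.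
have sumS (s' : seq A) : a \notin s' -> {subset s' <= s} ->
    span S (\sum_(x <- s') x *~ c x).
  move=> as' ss'; rewrite big_seq; apply: (big_ind (span S)).
  - exact: sSp.1.
  - by move=> x y; exact: (subgroupD sSp).
  move=> x xs'; apply: (subgroupMz _ sSp).
  have [xa|Sx] := sS x (ss' _ xs'); last exact: sub_span.
  by move: as'; rewrite -xa xs'.
have [as_|nas] := boolP (a \in s); last first.
  apply: indS sum0 => // x xs; have [xa|//] := sS x xs.
  by move: nas; rewrite -xa xs.
have sumE := sum0; rewrite (perm_big _ (perm_to_rem as_)) big_cons /= in sumE.
have a_rem : a \notin rem a s by rewrite mem_rem_uniq // !inE eqxx.
have rem_s : {subset rem a s <= s} by move=> x; exact: mem_rem.
have ca0 : c a = 0.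
  apply: contrapT => ca; apply: noM; exists (c a) => //.
  have -> : a *~ c a = - \sum_(x <- rem a s) x *~ c x.
    by apply/eqP; rewrite -addr_eq0; apply/eqP.
  exact: (subgroupN sSp (sumS _ a_rem rem_s)).
move=> x xs; have [->//|/eqP xa] := pselect (x = a).
rewrite ca0 mulr0z add0r in sumE.
apply: (indS _ _ (rem_uniq a us) _ sumE); last by rewrite mem_rem_uniq // !inE xa.
move=> y /= ys; have [ya|//] := sS y (rem_s _ ys).
by rewrite ya (negPf a_rem) in ys.
Qed.

Lemma max_independent_exists (A : zmodType) : exists S : set A, max_Z_independent S.
Proof.
have [F FI totF|S [indS maxS]] := @Zorn_bigcup A (@Z_independent A).
  move=> s c us sF.
  have [s0|[X FX sX]] : s = [::] \/ exists2 X, F X & [set` s] `<=` X.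
  - elim: s {c us} sF => [|x s IH] sF; [by left | right].
    have [X FX Xx] := sF x (mem_head _ _).
    have [|->|[Y FY sY]] := IH; first by move=> y ys; apply: sF; exact: mem_behead.
      by exists X => // y; rewrite /= inE => /eqP ->.
    have [XY|YX] := totF _ _ FX FY.
      exists Y => // y; rewrite /= inE => /orP[/eqP ->|]; [exact: XY | exact: sY].
    exists X => // y; rewrite /= inE => /orP[/eqP -> //|ys].
    by apply: YX; exact: sY.
  - by rewrite s0.
  - exact: (FI _ FX).
exists S; split=> // S' indS' SS'.
apply: contrapT => neq; apply: (maxS S') indS'; split=> // S'S.
by apply: neq; apply/seteqP.
Qed.

(** * Whitehead groups of finite rank *)

(** The subgroup generated by a list, in recursive form: adjoining one more
    generator is the only operation used on finitely generated subgroups. *)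
Fixpoint zspan (V : zmodType) (l : seq V) : set V :=
  if l is a :: l' then [set x | exists k : int, zspan l' (x - a *~ k)] else [set 0].

Lemma zspan_subgroup (V : zmodType) (l : seq V) : subgroup (zspan l).
Proof.
elim: l => [|a l IH]; first exact: subgroup0.
split; first by exists 0; rewrite mulr0z subr0; exact: IH.1.
move=> x y [k lx] [m ly]; exists (k - m).
by rewrite mulrzBr subrACA; apply: IH.2.
Qed.

Lemma zspan_cons (V : zmodType) (a : V) l : zspan l `<=` zspan (a :: l).
Proof. by move=> x lx; exists 0; rewrite mulr0z subr0. Qed.

Lemma zspan_head (V : zmodType) (a : V) l : zspan (a :: l) a.
Proof. by exists 1; rewrite mulr1z subrr; exact: (zspan_subgroup l).1. Qed.

Lemma mem_zspan (V : zmodType) (l : seq V) a : a \in l -> zspan l a.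
Proof.
elim: l => // b l IH; rewrite inE => /orP[/eqP ->|/IH al]; first exact: zspan_head.
exact: zspan_cons.
Qed.

Lemma zspan_finitely_generated (V : zmodType) (l : seq V) :
  finitely_generated_set (zspan l).
Proof.
exists (size l), (fun i => l`_i); elim: l => [|a l IH] /=.
  apply/seteqP; split=> [x ->|x [c _ <-]] /=; last by rewrite big_ord0.
  by exists (fun=> 0) => //; rewrite big_ord0.
apply/seteqP; split=> [x [k]|_ [c _ <-]].
  rewrite IH => -[c _ cE].
  exists (fun i => if unlift ord0 i is Some j then c j else k) => //.
  rewrite big_ord_recl unlift_none /=.
  under eq_bigr => i _ do rewrite liftK.
  by rewrite cE addrC subrK.
exists (c ord0); rewrite big_ord_recl addrC addKr IH.
by exists (fun i => c (lift ord0 i)).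
Qed.

Lemma finitely_generated_image (U V : zmodType) (f : {additive U -> V}) (X : set U) :
  finitely_generated_set X -> finitely_generated_set (f @` X).
Proof.
move=> [n [g ->]]; exists n, (f \o g).
have fE c : f (\sum_(i < n) g i *~ c i) = \sum_(i < n) f (g i) *~ c i.
  by rewrite raddf_sum; apply: eq_bigr => i _; rewrite raddfMz.
apply/seteqP; split=> [_ [_ [c _ <-] <-]|_ [c _ <-]].
  by exists c => //; rewrite fE.
by exists (\sum_(i < n) g i *~ c i); [exists c | rewrite fE].
Qed.

(** Characters that stabilize on each member of an increasing chain of
    subgroups define a character on the union, which extends by injectivity. *)
Lemma circle_character_limit (A : zmodType) (C : nat -> set A) (c : nat -> A -> rat) :
    (forall n, subgroup (C n)) -> (forall n, C n `<=` C n.+1) ->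
    (forall n, circle_character (c n)) ->
    (forall n x, C n x -> c n.+1 x - c n x \is a Num.int) ->
  exists2 r : A -> rat, circle_character r &
    forall n x, C n x -> c n x - r x \is a Num.int.
Proof.
move=> sC CS cc cS.
have Cle n m : (n <= m)%N -> C n `<=` C m.
  elim: m => [|m IH]; first by rewrite leqn0 => /eqP ->.
  rewrite leq_eqVlt => /orP[/eqP -> //|/IH Cnm].
  by apply: subset_trans Cnm _.
have cle n m x : (n <= m)%N -> C n x -> c m x - c n x \is a Num.int.
  move=> + Cx; elim: m => [|m IH]; first by rewrite leqn0 => /eqP ->; rewrite subrr.
  rewrite leq_eqVlt => /orP[/eqP -> |nm]; first by rewrite subrr.
  rewrite -[_ - _](subrKA (c m x)) rpredD ?IH //.
  by apply: cS; apply: Cle Cx.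
pose R := [set p : A * rat | exists n, C n p.1 /\
  forall m, (n <= m)%N -> p.2 - c m p.1 \is a Num.int].
have [||r rc rR] := @extend_circle_character A R.
- split.
    exists 0%N; split=> [|m _ /=]; first exact: (sC 0%N).1.
    by rewrite sub0r rpredN circle_character0.
  move=> p q [n [Cp pI]] [m [Cq qI]]; exists (maxn n m); split.
    apply: (sC _).2; [exact: Cle (leq_maxl n m) _ Cp | exact: Cle (leq_maxr n m) _ Cq].
  move=> k; rewrite geq_max => /andP[nk mk].
  have -> : (p - q).2 - c k (p - q).1 = (p.2 - c k p.1) - (q.2 - c k q.1)
        - (c k (p.1 - q.1) - (c k p.1 - c k q.1)).
    by rewrite (subrACA p.2) (subrACA (p.2 - q.2)) subrr subr0.
  by apply: rpredB; [apply: rpredB; [exact: pI | exact: qI] | exact: cc].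
- move=> q [n [_ /(_ n (leqnn n)) /= qI]].
  by rewrite -(subrK (c n 0) q) rpredD // circle_character0.
exists r => // n x Cx; apply: rR; exists n; split=> // m nm /=.
by rewrite -opprB rpredN cle.
Qed.

(** An additive map to Q is determined by its values on S, since these
    determine it on the span of S, which contains a nonzero multiple of every
    element. On the maps considered, these values are finitely many integers. *)
Lemma integral_characters_countable (A : zmodType) (S : set A) :
    finite_set S -> (forall a, exists2 m : int, m <> 0 & span S (a *~ m)) ->
  exists e : nat -> {additive A -> rat}, forall g : {additive A -> rat},
    (forall x, S x -> g x \is a Num.int) -> exists n, g =1 e n.
Proof.
move=> /finite_seqP[s SE] torS.
pose code (g : {additive A -> rat}) := pickle [seq numq (g x) | x <- s].
pose intS (g : {additive A -> rat}) := forall x, S x -> g x \is a Num.int.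
have codeI (g h : {additive A -> rat}) : intS g -> intS h -> code g = code h -> g =1 h.
  move=> gS hS /(pcan_inj pickleK)/eq_in_map gh a.
  have [m m_neq0 am] := torS a.
  have : span S `<=` [set x | g x = h x].
    apply: span_min.
      split; first by rewrite /= !raddf0.
      by move=> x y /= gx gy; rewrite !raddfB gx gy.
    move=> x Sx /=; rewrite -(numqK (gS _ Sx)) -(numqK (hS _ Sx)) /= gh //.
    by move: Sx; rewrite SE.
  move=> /(_ _ am) /=; rewrite !raddfMz -[g a *~ m]mulrzr -[h a *~ m]mulrzr => /mulIf; apply.
  by rewrite intr_eq0; apply/eqP.
have /choice[e eE] n : exists e : {additive A -> rat}, forall g, intS g -> code g = n -> g =1 e.
  have [[h [hS <-]]|no] := pselect (exists h, intS h /\ code h = n).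
    by exists h => g gS gh; exact: codeI.
  have [|z _] := @additiveP A rat (fun=> 0); first by move=> x y; rewrite subrr.
  by exists z => g gS gn; exfalso; apply: no; exists g.
by exists e => g gS; exists (code g); exact: eE.
Qed.

(** Let S be a finite maximal independent set, and suppose that A is not
    finitely generated. Then there is a strictly increasing sequence of
    finitely generated subgroups that starts with the span of S, and the
    characters that vanish on S can be chosen independently at each step. There
    are uncountably many of them, but all lift to homomorphisms A -> Q that are
    integral on S, of which there are countably many. The proof diagonalizes:
    the n-th step makes the character differ from the n-th such homomorphism. *)
Lemma Whitehead_finite_rank (A : zmodType) :
  Whitehead A -> ~ infinite_rank A -> finitely_generated_set [set: A].
Proof.
move=> /Whitehead_lift lift fin.
have [S maxS] := max_independent_exists A.
have finS : finite_set S by apply: contrapT => infS; apply: fin; exists S.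
have [e eP] := integral_characters_countable finS (torsion_mod_max_independent maxS).
have /finite_seqP[s SE] := finS.
apply: contrapT => nfg.
have /choice[a aP] (l : seq A) : exists a, ~ zspan l a.
  apply: contrapT => no; apply: nfg.
  suff <- : zspan l = setT by exact: zspan_finitely_generated.
  by apply/seteqP; split=> // x _; apply: contrapT => lx; apply: no; exists x.
pose L n := iter n (fun l => a l :: l) s.
have /choice[t tP] n := separating_character (zspan_subgroup (L n)) (aP (L n)).
(* Modulo Z, adding t n leaves the character unchanged on the span of L n, but
   changes its value at the new generator. *)
pose chi := fix chi n := if n is m.+1 then
  (if chi m (a (L m)) - e m (a (L m)) \is a Num.int then chi m + t m else chi m)
  else 0.
have chiD n : circle_character (chi n).
  elim: n => [|n IH] x y /=; first by rewrite !subrr.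
  case: ifP => _; last exact: IH.
  have [tc _ _] := tP n.
  have -> : (chi n + t n) (x - y) - ((chi n + t n) x - (chi n + t n) y) =
     (chi n (x - y) - (chi n x - chi n y)) + (t n (x - y) - (t n x - t n y)).
    have E (p q p1 q1 p2 q2 : rat) : (p + q) - ((p1 + q1) - (p2 + q2)) =
        (p - (p1 - p2)) + (q - (q1 - q2)) by ring.
    exact: E.
  exact: rpredD.
have chiS n x : zspan (L n) x -> chi n.+1 x - chi n x \is a Num.int.
  move=> Lx /=; case: ifP => _; last by rewrite subrr.
  have [_ tL _] := tP n.
  have -> : (chi n + t n) x - chi n x = t n x by rewrite addrC addKr.
  exact: tL.
have chi_e n : chi n.+1 (a (L n)) - e n (a (L n)) \isn't a Num.int.
  rewrite /=; case: ifP => [chiI|->//].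
  have [_ _ ta] := tP n; apply: contra ta => chitI.
  have -> : t n (a (L n)) = ((chi n + t n) (a (L n)) - e n (a (L n))) -
     (chi n (a (L n)) - e n (a (L n))).
    by rewrite subrACA subrr subr0 addrC addKr.
  exact: rpredB.
have [||r rc rL] := @circle_character_limit A (fun n => zspan (L n)) chi _ _ chiD chiS.
- by move=> n; exact: zspan_subgroup.
- by move=> n; exact: zspan_cons.
have [g gI] := lift r rc.
have [|n gE] := eP g.
  move=> x; rewrite SE => xs; have := rL 0%N x (mem_zspan xs).
  by rewrite /= sub0r rpredN => rI; rewrite -(subrK (r x) (g x)) rpredD.
move/negP: (chi_e n); apply; rewrite -gE.
rewrite -[_ - _](subrKA (r (a (L n)))) rpredD //.
  by apply: rL; exact: zspan_head.
by rewrite -opprB rpredN.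
Qed.

(** * Filtrations with Whitehead quotients *)

Lemma well_founded_minimal (T : Type) (lt : T -> T -> Prop) (P : set T) :
  well_founded lt -> P !=set0 -> exists2 m, P m & forall x, lt x m -> ~ P x.
Proof.
move=> wf [x0 Px0]; apply: contrapT => no.
elim/(well_founded_ind wf): x0 Px0 => x IH Px.
by apply: no; exists x.
Qed.

Lemma well_founded_asym (T : Type) (lt : T -> T -> Prop) x y :
  well_founded lt -> lt x y -> ~ lt y x.
Proof.
move=> wf; elim/(well_founded_ind wf): x y => x IH y xy yx.
exact: (IH _ yx _ yx xy).
Qed.

(** Each generator map u_j is additive modulo what the lower indices generate,
    and the coordinate p_j detects the argument of u_j while it vanishes on
    all other generators except those of higher indices. So adjoining u_j to
    a downward closed set of generators is an extension by H_j. *)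
Section Filtration.
Variables (V : zmodType) (J : Type) (lt : J -> J -> Prop) (H E : J -> zmodType).
Variables (u : forall j, H j -> V) (p : forall j, {additive V -> E j}).

Arguments u : clear implicits.
Arguments p : clear implicits.

Definition generated (S : set J) : set V :=
  span [set v | exists j, S j /\ exists h, v = u j h].

Lemma generated_sub (S S' : set J) : S `<=` S' -> generated S `<=` generated S'.
Proof.
move=> SS'; apply: span_min; first exact: span_subgroup.
by move=> _ [j [Sj [h ->]]]; apply: sub_span; exists j; split; [exact: SS' | exists h].
Qed.

Lemma mem_generated (S : set J) j h : S j -> generated S (u j h).
Proof. by move=> Sj; apply: sub_span; exists j; split=> //; exists h. Qed.

Hypothesis lt_wf : well_founded lt.
Hypothesis u_mod : forall j h k,
  generated (lt ^~ j) (u j (h - k) - (u j h - u j k)).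
Arguments u_mod : clear implicits.
Hypothesis p_other : forall i j h, i <> j -> ~ lt j i -> p j (u i h) = 0.
Hypothesis p_faithful : forall j h, p j (u j h) = 0 -> h = 0.

Lemma generated_coordinate0 (S : set J) j :
  (forall i, S i -> i <> j /\ ~ lt j i) -> forall x, generated S x -> p j x = 0.
Proof.
move=> Sj; apply: (@span_min _ _ [set x | p j x = 0]).
  split; first by rewrite /= raddf0.
  by move=> x y /= px py; rewrite raddfB px py subrr.
by move=> _ [i [Si [h ->]]] /=; have [ij ji] := Sj i Si; apply: p_other.
Qed.

Hypothesis H_neq0 : forall j, exists h : H j, h <> 0.
Hypothesis H_Whitehead : forall j, Whitehead (H j).

Arguments H_Whitehead : clear implicits.

(** A character c of U is lifted along the filtration. Zorn's lemma is applied to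
    graphs of partial lifts to Q whose domain is generated by a downward closed
    set S of indices. If j is minimal outside S, extend the partial lift to an
    additive map g : V -> Q; the difference of c and g at u_j(h) is a character
    of H_j, which lifts since H_j is Whitehead. *)
Lemma Whitehead_filtration (U : zmodType) (i : {additive U -> V}) :
  injective i -> range i = generated setT -> Whitehead U.
Proof.
move=> i_inj iE; apply/Whitehead_lift => c cc.
have c0 := circle_character0 cc.
pose Rc := [set q : V * rat | exists w, q.1 = i w /\ q.2 - c w \is a Num.int].
have sRc : subgroup Rc.
  split; first by exists 0; rewrite raddf0 sub0r rpredN.
  move=> q r [w [qw qI]] [z [rz rI]]; exists (w - z); split.
    by rewrite raddfB -qw -rz.
  have -> : (q - r).2 - c (w - z) = (q.2 - c w) - (r.2 - c z)
      - (c (w - z) - (c w - c z)).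
    by rewrite (subrACA q.2) (subrACA (q.2 - r.2)) subrr subr0.
  by apply: rpredB; [exact: rpredB | exact: cc].
have Rc0 q : Rc (0, q) -> q \is a Num.int.
  move=> [w [/esym w0 qI]]; have w00 : w = 0 by apply: i_inj; rewrite w0 raddf0.
  by rewrite -(subrK (c w) q) rpredD // w00.
have Rc_tot x : generated setT x -> exists q, Rc (x, q).
  by rewrite -iE => -[w _ <-]; exists (c w), w; rewrite subrr.
pose down (S : set J) := forall j k, S j -> lt k j -> S k.
pose dom (R : set (V * rat)) (S : set J) := [set x | exists q, R (x, q)] = generated S.
pose P (R : set (V * rat)) := [/\ subgroup R, R `<=` Rc,
  forall q, R (0, q) -> q = 0 & exists2 S, down S & dom R S].
have [|F FP [R0 FR0] totF|R [[sR RRc R_fun [S dS domR]] _ maxR]] :=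
  @Zorn_above _ P [set 0].
- split.
  + exact: subgroup0.
  + by move=> q q0; rewrite (_ : q = 0) //; exact: sRc.1.
  + by move=> q [].
  exists set0; first by [].
  apply/seteqP; split=> [x [q [-> _]]|]; first exact: (span_subgroup _).1.
  apply: span_min; last by move=> x [j []].
  split; first by exists 0.
  by move=> x y [q [-> _]] [r [-> _]]; exists 0; rewrite subrr.
- have sF : subgroup (\bigcup_(R in F) R).
    split; first by exists R0 => //; have [[]] := FP _ FR0.
    move=> q r [R1 F1 R1q] [R2 F2 R2r].
    have [[_ R1B] _ _ _] := FP _ F1; have [[_ R2B] _ _ _] := FP _ F2.
    have [R12|R21] := totF _ _ F1 F2.
      by exists R2 => //; apply: R2B => //; apply: R12.
    by exists R1 => //; apply: R1B => //; apply: R21.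
  split=> //.
  + by move=> q [R FR Rq]; have [_ RRc _ _] := FP _ FR; apply: RRc.
  + by move=> q [R FR Rq]; have [_ _ R_fun _] := FP _ FR; apply: R_fun.
  exists [set j | exists R S, [/\ F R, down S, dom R S & S j]].
    by move=> j k [R [S [FR dS RS Sj]]] kj; exists R, S; split=> //; apply: dS kj.
  apply/seteqP; split=> [x [q [R FR Rxq]]|].
    have [_ _ _ [S dS RS]] := FP _ FR.
    have : generated S x by rewrite -RS; exists q.
    by apply: generated_sub => j Sj; exists R, S.
  apply: span_min; first split; first by exists 0; exact: sF.1.
    by move=> x y [q xq] [r yr]; exists (q - r); apply: (sF.2 _ _ xq yr).
  move=> _ [j [[R [S [FR dS RS Sj]]] [h ->]]].
  have : [set x | exists q, R (x, q)] (u j h) by rewrite RS; apply: mem_generated.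
  by case=> q Rq; exists q, R.
have ST : S = setT.
  apply/seteqP; split=> // j0 _; apply: contrapT => nj0.
  have [|j nSj minj] := @well_founded_minimal _ lt (~` S) lt_wf; first by exists j0.
  have ltS : lt ^~ j `<=` S by move=> k kj; apply: contrapT; exact: minj.
  have [g [g0 gR]] := divisible_extension divisible_rat sR.
  have gB : zmod_morphism g.
    by move=> x y; apply/eqP; rewrite -subr_eq0; apply/eqP/R_fun/g0.
  have [g' g'E] := additiveP gB.
  have gval x q : R (x, q) -> q = g x.
    by move=> /gR/R_fun/eqP; rewrite subr_eq0 => /eqP.
  have Rg x : generated S x -> R (x, g x).
    by rewrite -domR => -[q Rxq]; rewrite -(gval _ _ Rxq).
  have /choice[y yP] h : exists q, Rc (u j h, q) by apply: Rc_tot; exact: mem_generated.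
  have [|a aI] := (Whitehead_lift _).1 (H_Whitehead j) (fun h => y h - g (u j h)).
    move=> h k.
    have := sRc.2 _ _ (sRc.2 _ _ (yP (h - k)) (sRc.2 _ _ (yP h) (yP k)))
      (RRc _ (Rg _ (generated_sub ltS (u_mod j h k)))).
    rewrite !pairB subrr => /Rc0; rewrite !gB.
    by rewrite (subrACA (y h)) (subrACA (y (h - k))).
  (* The lift g + a on the group generated by S and u_j. *)
  pose R' := [set q | exists x h, generated S x /\ q = (x + u j h, g x + g (u j h) + a h)].
  have sR' : subgroup R'.
    have u0 : generated S (u j 0).
      by have := generated_sub ltS (u_mod j 0 0); rewrite !subrr subr0.
    split.
      exists (- u j 0), 0; split; first exact: (subgroupN (span_subgroup _)).
      by rewrite addNr -g'E -g'E raddfN raddf0 addr0 addNr.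
    move=> _ _ [x [h [Sx ->]]] [z [k [Sz ->]]].
    exists ((x - z) - (u j (h - k) - (u j h - u j k))), (h - k); split.
      apply: (span_subgroup _).2; first exact: (span_subgroup _).2.
      exact: generated_sub ltS _ (u_mod j h k).
    rewrite pairB; congr (_, _).
      by rewrite opprB -[RHS]addrA subrK opprD addrACA.
    by rewrite !gB (raddfB a); ring.
  have R'R : R' = R.
    apply: maxR; last first.
      move=> [x q] Rxq; have -> := gval _ _ Rxq.
      have Sx : generated S x by rewrite -domR; exists q.
      exists (x - u j 0), 0; split; last by rewrite gB raddf0 addr0 !subrK.
      apply: (span_subgroup _).2 => //.
      by have := generated_sub ltS (u_mod j 0 0); rewrite !subrr subr0.
    split=> //.
    + move=> _ [x [h [Sx ->]]].
      have gy : Rc (u j h, g (u j h) + a h).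
        have [w [uw yI]] := yP h; exists w; split=> //=.
        have -> : g (u j h) + a h - c w = (a h - (y h - g (u j h))) + (y h - c w) by ring.
        exact: rpredD.
      by rewrite -addrA; exact: (subgroupD sRc (RRc _ (Rg _ Sx)) gy).
    + move=> q [x [h [Sx [/esym xu ->]]]].
      have px : p j x = 0.
        apply: generated_coordinate0 Sx => k Sk.
        split=> [kj|jk]; first by rewrite kj in Sk.
        by apply: nSj; apply: dS jk.
      have h0 : h = 0.
        by apply: p_faithful; rewrite -(add0r (p j _)) -px -raddfD xu raddf0.
      by rewrite h0 raddf0 addr0 -h0 -!g'E -raddfD xu raddf0.
    exists (S `|` [set j]).
      by move=> k l [Sk|->] lk; left; [exact: dS lk | exact: ltS].
    apply/seteqP; split=> [_ [q [x [h [Sx [-> _]]]]]|].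
      apply: (subgroupD (span_subgroup _)).
        by apply: generated_sub Sx; left.
      by apply: mem_generated; right.
    apply: span_min.
      split; first by exists 0; exact: sR'.1.
      by move=> x z [q xq] [r zr]; exists (q - r); apply: (sR'.2 _ _ xq zr).
    move=> _ [k [[Sk|->] [h ->]]].
      exists (g (u k h) + g (- u j 0) + g (u j 0) + a 0), (u k h - u j 0), 0; split.
        apply: (span_subgroup _).2; first exact: mem_generated.
        by have := generated_sub ltS (u_mod j 0 0); rewrite !subrr subr0.
      by rewrite subrK -!g'E raddfB raddfN.
    exists (g 0 + g (u j h) + a h), 0, h; split; first exact: (span_subgroup _).1.
    by rewrite add0r.
  (* By maximality u_j takes its values in the domain, where p_j vanishes. *)
  have [h h_neq0] := H_neq0 j; apply: h_neq0; apply: p_faithful.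
  have : generated S (u j h).
    rewrite -domR -R'R; exists (g 0 + g (u j h) + a h), 0, h.
    by split; [exact: (span_subgroup _).1 | rewrite add0r].
  apply: generated_coordinate0 => k Sk.
  split=> [kj|jk]; first by rewrite kj in Sk.
  by apply: nSj; apply: dS jk.
have /choice[g gP] w : exists q, R (i w, q).
  have : range i (i w) by exists w.
  by rewrite iE -ST -domR.
have [|g' g'E] := @additiveP _ _ g.
  move=> x y; apply/eqP; rewrite -subr_eq0; apply/eqP/R_fun.
  have := sR.2 _ _ (gP (x - y)) (sR.2 _ _ (gP x) (gP y)).
  by rewrite !pairB raddfB subrr.
exists g' => w; rewrite g'E.
by have [z [/i_inj -> zI]] := RRc _ (gP w).
Qed.

End Filtration.

(** * Nonsplit extensions along a homomorphism *)

Definition additive_on (V B : zmodType) (X : set V) (f : V -> B) : Prop :=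
  forall x y, X x -> X y -> f (x - y) = f x - f y.

(** The factor set of the extension that c describes. *)
Definition defect (A V : zmodType) (c : A -> V) (h k : A) : V :=
  c (h - k) - (c h - c k).

(** Let E be a nonsplit extension of H by A, where A = range i is the image of X
    under f, and let N be the kernel of f on X. The isomorphism of A with X/N
    extends to a homomorphism r from E to V/N, and c(h) = r(e(h)) for a
    set-theoretic section e of E. Then f sends the defect of c to that of e. A
    map b with values in A and with the same defect as e would turn e - b into an
    additive section. *)
Lemma nonsplit_lift (V U B H : zmodType) (i : {additive U -> B})
    (X : set V) (f : V -> B) :
    divisible V -> injective i -> ~ Ext_eq0 H U -> subgroup X ->
    additive_on X f -> f @` X = range i ->
  exists c : H -> V, (forall h k, X (defect c h k)) /\
    ~ exists a : H -> B, (forall h, (f @` X) (a h)) /\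
        forall h k, defect a h k = f (defect c h k).
Proof.
move=> divV i_inj nExt sX fB fX.
have [E nsec] : exists E : extension H U,
    ~ exists s : {additive H -> E}, cancel s (ext_out E).
  apply: contrapT => no; apply: nExt; apply/Ext_eq0_section => E.
  by apply: contrapT => nsec; apply: no; exists E.
have f0 : f 0 = 0 by have := fB 0 0 sX.1 sX.1; rewrite !subrr.
pose R := [set q : E * V | exists z, [/\ q.1 = ext_in E z, X q.2 & f q.2 = i z]].
have [|r [rB rR]] := @divisible_extension E V R divV.
  split; first by exists 0; rewrite !raddf0; split=> //; exact: sX.1.
  move=> p q [z [pz Xp fp]] [w [qw Xq fq]]; exists (z - w).
  by rewrite !raddfB -pz -qw -fp -fq; split=> //; [exact: sX.2 | exact: fB].
pose N v := X v /\ f v = 0.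
have sN : subgroup N.
  split; first by split; first exact: sX.1.
  move=> v w [Xv fv] [Xw fw]; split; first exact: sX.2.
  by rewrite fB // fv fw subrr.
have RN v : R (0, v) -> N v.
  move=> [z [/= z0 Xv fv]]; split=> //.
  have -> : 0 = i 0 by rewrite raddf0.
  by rewrite fv; congr (i _); apply: (@ext_in_inj _ _ E); rewrite -z0 raddf0.
have kerE x : ext_out E x = 0 -> exists z, ext_in E z = x.
  move=> x0; have : range (ext_in E) x by rewrite ext_exact.
  by case=> z _ <-; exists z.
have inK w : ext_out E (ext_in E w) = 0.
  have : range (ext_in E) (ext_in E w) by exists w.
  by rewrite ext_exact.
have /choice[e eK] a : exists x, ext_out E x = a.
  have : range (ext_out E) a by rewrite ext_out_surj.
  by case=> x _ <-; exists x.
pose c h := r (e h).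
have cP h k : exists z, [/\ ext_in E z = defect e h k, X (defect c h k) &
    f (defect c h k) = i z].
  have [|z zE] := kerE (defect e h k); first by rewrite 2!raddfB !eK subrr.
  have [v Xv fv] : (f @` X) (i z) by rewrite fX; exists z.
  have [Xw fw] : N (v - defect c h k).
    have -> : v - defect c h k = (v - r (defect e h k)) +
        (r (e (h - k) - (e h - e k)) - (c (h - k) - r (e h - e k)) -
         (r (e h - e k) - (c h - c k))).
      rewrite /defect (subrACA (r _)) [c (h - k) - _ - _]addrAC subrACA.
      by rewrite subrr subr0 subrKA.
    apply: (subgroupD sN); first by apply/RN/rR; exists z; rewrite zE.
    by apply: sN.2; apply/RN/rB.
  have cE : defect c h k = v - (v - defect c h k) by rewrite opprB addrC subrK.
  exists z; split=> //; first by rewrite cE; apply: sX.2.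
  by rewrite cE fB // fw subr0.
exists c; split=> [h k|[a [aX aE]]]; first by have [z []] := cP h k.
have /choice[b bE] h : exists z, i z = a h.
  by have := aX h; rewrite fX => -[z _ <-]; exists z.
pose s h := e h - ext_in E (b h).
apply: nsec; have [|s' s'E] := @additiveP _ _ s; last first.
  by exists s' => h; rewrite s'E raddfB eK inK subr0.
move=> h k; have [z [zE Xc fc]] := cP h k.
apply/eqP; rewrite -subr_eq0; apply/eqP.
have -> : s (h - k) - (s h - s k) =
    defect e h k - (ext_in E (b (h - k)) - (ext_in E (b h) - ext_in E (b k))).
  by rewrite /s /defect (subrACA (e h)) (subrACA (e (h - k))).
rewrite -zE -!(raddfB (ext_in E)).
suff -> : z = b (h - k) - (b h - b k) by rewrite subrr raddf0.
by apply: i_inj; rewrite -fc -aE /defect -!bE !raddfB.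
Qed.

Lemma Whitehead_int : Whitehead int.
Proof.
apply/Ext_eq0_section => E.
have [e _ eE] : range (ext_out E) 1 by rewrite ext_out_surj.
have [|s sE] := @additiveP _ _ (fun z => e *~ z); first by move=> x y; rewrite mulrzBr.
by exists s => z; rewrite sE raddfMz eE intz.
Qed.

Lemma nonsplit_neq0 (H U : zmodType) : ~ Ext_eq0 H U -> exists h : H, h <> 0.
Proof.
move=> nExt; apply: contrapT => no; apply: nExt; apply/Ext_eq0_section => E.
have [|s sE] := @additiveP H E (fun=> 0); first by move=> x y; rewrite subrr.
exists s => h; rewrite sE raddf0.
by apply: contrapT => h0; apply: no; exists h => /esym.
Qed.

Section Tree.
Variable K : Type.

(** Ordinals without linearity. A family of trees indexed by K has a strict upper
    bound by construction, which replaces a cofinality argument. *)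
Inductive tree := leaf | node of (K -> tree).

Fixpoint below (x y : tree) : Prop :=
  if y is node f then exists k, x = f k \/ below x (f k) else False.

Lemma below_trans x y z : below x y -> below y z -> below x z.
Proof.
elim: z => // f IH xy [k [yk|yk]]; exists k; right; first by rewrite -yk.
exact: IH.
Qed.

Lemma below_wf : well_founded below.
Proof.
move=> x; suff [] : Acc below x /\ forall y, below y x -> Acc below y by [].
elim: x => [|f IH]; first by split=> //; constructor.
suff fA y : below y (node f) -> Acc below y by split=> //; constructor.
by move=> [k [->|yk]]; have [fk fkA] := IH k; [|apply: fkA].
Qed.

Lemma below_bound (f : K -> tree) : exists y, forall k, below (f k) y.
Proof. by exists (node f) => k; exists k; left. Qed.

End Tree.

Arguments leaf {K}.

(** The tasks are the pairs of a level a and a function to B, to be destroyed at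
    level a, from the vectors whose coordinates belong to tasks of lower levels.
    These vectors are arbitrary, not only those of the tower, so that the
    recursion that defines the types does not involve the subgroups of the
    tower. A task has one coordinate for each homomorphism from a group [Hf A]
    to Q: they serve to embed [Hf A]. *)
Section Construction.
Variables (K : Type) (B : zmodType) (Hf : set B -> zmodType).

Let coord := {A : set B & {additive Hf A -> rat}}.

Let label_step (a : tree K)
    (label : forall b, below b a -> Type) : Type :=
  (forall b (ba : below b a), label b ba -> coord -> rat) -> B.

Definition label : tree K -> Type :=
  Fix (@below_wf K) (fun=> Type) label_step.

Lemma labelE a :
  label a = ((forall b, below b a -> label b -> coord -> rat) -> B).
Proof.
rewrite /label Fix_eq // => x f g fg.
by congr label_step; apply/functional_extensionality_dep => b; apply/functional_extensionality_dep.
Qed.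

Definition task : Type := {a : tree K & label a}.

Definition level (j : task) : tree K := projT1 j.

Definition ambient : Type := task * coord -> rat.

Definition supported (a : tree K) : set ambient :=
  [set v | forall j t, ~ below (level j) a -> v (j, t) = 0].

(** A function on V is seen by the tasks of level a through its values at the
    vectors supported below a. *)
Lemma decode_exists : exists d : task -> ambient -> B,
  forall a (f : ambient -> B), exists2 j, level j = a &
    forall v, supported a v -> d j v = f v.
Proof.
have cast (X Y : Type) : X = Y -> exists d : X -> Y, forall y, exists x, d x = y.
  by move=> <-; exists id => x; exists x.
have dec a := cid (cast _ _ (labelE a)).
exists (fun j v => projT1 (dec (level j)) (projT2 j)
  (fun b _ i t => v (existT _ b i, t))) => a f.
pose F (x : forall b, below b a -> label b -> coord -> rat) : B :=
  f (fun q => match pselect (below (level q.1) a) with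
     | left ba => x _ ba (projT2 q.1) q.2
     | right _ => 0 end).
have [i iF] := projT2 (dec a) F.
exists (existT _ a i) => // v va.
transitivity (projT1 (dec a) i (fun b _ l t => v (existT _ b l, t))) => //.
rewrite iF /F; congr f.
apply/funext => -[[b l] t] /=; case: pselect => // nba.
by rewrite va.
Qed.

Definition decode := projT1 (cid decode_exists).

Lemma decode_surj a (f : ambient -> B) : exists2 j, level j = a &
  forall v, supported a v -> decode j v = f v.
Proof. exact: (projT2 (cid decode_exists)). Qed.

End Construction.

(** * The tower *)

Lemma divisible_fun (T : Type) : divisible (T -> rat).
Proof.
move=> v n n_gt0; have /choice[w wE] t : exists q, q *+ n = v t by exact: divisible_rat.
exists w; apply/funext => t; rewrite -wE.
by elim: n {n_gt0 wE} => // n IH; rewrite !mulrS -IH.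
Qed.

Section Tower.
Variables (K : Type) (B : zmodType) (Hf : set B -> zmodType).
Hypothesis Hf_Whitehead : forall A, Whitehead (Hf A).
Hypothesis Hf_neq0 : forall A, exists h : Hf A, h <> 0.
Hypothesis Hf_nonsplit : forall A (U : zmodType) (i : {additive U -> B}),
  injective i -> range i = A -> infinite_rank U ->
  exists (U' : zmodType) (i' : {additive U' -> B}),
    [/\ injective i', range i' = A & ~ Ext_eq0 (Hf A) U'].

Local Notation task := (task K Hf).
Local Notation V := (ambient K Hf).

Definition has_infinite_rank (A : set B) : Prop :=
  exists (U : zmodType) (i : {additive U -> B}),
    [/\ injective i, range i = A & infinite_rank U].

Definition truncate (a : tree K) (v : V) : V :=
  fun q => if pselect (below (level q.1) a) then v q else 0.

Lemma truncate_supported a v : supported a (truncate a v).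
Proof. by move=> j t nja; rewrite /truncate /=; case: pselect. Qed.

Lemma truncate_id a v : supported a v -> truncate a v = v.
Proof.
move=> va; apply/funext => -[j t]; rewrite /truncate /=.
by case: pselect => // nja; rewrite va.
Qed.

Lemma truncateB a : zmod_morphism (truncate a).
Proof.
move=> v w; apply/funext => q; rewrite [RHS]/(_ - _) /= /truncate.
by case: pselect => //= _; rewrite subr0.
Qed.

Lemma supported_subgroup a : subgroup (supported a : set V).
Proof.
split=> [j t //|v w va wa j t nja].
by rewrite -[LHS]/(v (j, t) - w (j, t)) va // wa // subrr.
Qed.

(** The additive-up-to-X part of the extension that destroys f. The vectors
    provided by [nonsplit_lift] may be truncated below level a, because their
    defects are supported there. Tasks whose function is not to be
    destroyed get the split extension c = 0. *)
Lemma twist_exists (a : tree K) (X : set V) (f : V -> B) :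
  exists c : Hf (f @` X) -> V, [/\ forall h, supported a (c h),
    subgroup X -> X `<=` supported a -> forall h k, X (defect c h k) &
    subgroup X -> X `<=` supported a -> additive_on X f ->
      has_infinite_rank (f @` X) ->
      ~ exists b : Hf (f @` X) -> B, (forall h, (f @` X) (b h)) /\
          forall h k, defect b h k = f (defect c h k)].
Proof.
have [[sX [Xa [fB [U [i [i_inj iE iU]]]]]]|no] :=
    pselect (subgroup X /\ X `<=` supported a /\ additive_on X f /\
      has_infinite_rank (f @` X)); last first.
  exists (fun=> 0); split=> [h|sX Xa h k|sX Xa fB fX].
  - exact: (supported_subgroup a).1.
  - by rewrite /defect !subrr; exact: sX.1.
  - by exfalso; apply: no.
have [U' [i' [i'_inj i'E nExt]]] := Hf_nonsplit i_inj iE iU.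
have [c [cX nob]] := nonsplit_lift (@divisible_fun _) i'_inj nExt sX fB (esym i'E).
have cE h k : defect (truncate a \o c) h k = defect c h k.
  by rewrite /defect /= -!truncateB truncate_id //; apply/Xa/cX.
exists (truncate a \o c); split=> [h|_ _ h k|_ _ _ _ [b [bX bE]]].
- exact: truncate_supported.
- by rewrite cE.
- by apply: nob; exists b; split=> // h k; rewrite bE cE.
Qed.

Definition twist a X f := projT1 (cid (twist_exists a X f)).

Arguments twist : clear implicits.

(** The canonical map from [Hf A] to its double dual over Q, with value 0 at the
    homomorphisms defined on the other groups of the family. *)
Definition evaluation (A : set B) (h : Hf A)
    (t : {A : set B & {additive Hf A -> rat}}) : rat :=
  match pselect (A = projT1 t) with
  | left e => projT2 t (eq_rect A (fun A' => Hf A' : Type) h _ e)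
  | right _ => 0
  end.

Lemma evaluationE A (h : Hf A) (x : {additive Hf A -> rat}) :
  evaluation h (existT _ A x) = x h.
Proof.
rewrite /evaluation /=; case: pselect => // e.
by rewrite (Prop_irrelevance e erefl).
Qed.

Lemma evaluationB A (h k : Hf A) t : evaluation (h - k) t = evaluation h t - evaluation k t.
Proof.
case: t => A' x; rewrite /evaluation /=; case: pselect => [e|_]; last by rewrite subrr.
by case: _ / e x => x; rewrite /= raddfB.
Qed.

Definition embed_at (j : task) (A : set B) (h : Hf A) : V :=
  fun q => if pselect (q.1 = j) then evaluation h q.2 else 0.

Lemma embed_atB j A (h k : Hf A) : embed_at j (h - k) = embed_at j h - embed_at j k.
Proof.
apply/funext => q; rewrite [RHS]/(_ - _) /= /embed_at.
by case: pselect => //= _; exact: evaluationB.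
Qed.

Let tower_step (a : tree K) (tower : forall b, below b a -> set V) : set V :=
  span [set v | exists (j : task) (ja : below (level j) a)
    (h : Hf (decode j @` tower _ ja)),
    v = twist (level j) (tower _ ja) (decode j) h + embed_at j h].

Definition tower : tree K -> set V := Fix (@below_wf K) (fun=> set V) tower_step.

Definition target (j : task) : set B := decode j @` tower (level j).

(** The generators that task j adds: lifts of the elements of the new quotient
    [Hf (target j)]. *)
Definition generator (j : task) (h : Hf (target j)) : V :=
  twist (level j) (tower (level j)) (decode j) h + embed_at j h.

Lemma towerE a : tower a = generated generator [set j | below (level j) a].
Proof.
rewrite /tower Fix_eq; last first.
  move=> x f g fg; congr tower_step.
  by apply/functional_extensionality_dep => b; apply/functional_extensionality_dep.
congr span; apply/seteqP; split=> [v [j [ja [h ->]]]|v [j [ja [h ->]]]].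
  by exists j; split=> //; exists h.
by exists j, ja, h.
Qed.

Lemma tower_subgroup a : subgroup (tower a).
Proof. by rewrite towerE; exact: span_subgroup. Qed.

Lemma embed_at_supported a j A (h : Hf A) : below (level j) a -> supported a (embed_at j h).
Proof.
by move=> ja k t nka; rewrite /embed_at /=; case: pselect => // kj; rewrite kj in nka.
Qed.

Lemma twist_supported a X f h : supported a (@twist a X f h).
Proof. by have [cs _ _] := projT2 (cid (twist_exists a X f)); exact: cs. Qed.

Lemma tower_supported a : tower a `<=` supported a.
Proof.
rewrite towerE; apply: span_min; first exact: supported_subgroup.
move=> _ [j [ja [h ->]]]; apply: (subgroupD (supported_subgroup a)).
  move=> k t nka; apply: (@twist_supported (level j)) => kj.
  exact: nka (below_trans kj ja).
exact: embed_at_supported.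
Qed.

Lemma generator_defect j h k :
  defect (@generator j) h k =
  defect (twist (level j) (tower (level j)) (decode j)) h k.
Proof.
rewrite /defect /generator embed_atB (opprD (twist _ _ _ k)).
by rewrite (addrACA (twist _ _ _ h)) opprD addrACA subrr addr0.
Qed.

Lemma generator_mod j h k : tower (level j) (defect (@generator j) h k).
Proof.
rewrite generator_defect.
have [_ cX _] := projT2 (cid (twist_exists (level j) (tower (level j)) (decode j))).
apply: cX; [exact: tower_subgroup | exact: tower_supported].
Qed.

Definition coordinate_space (j : task) : zmodType :=
  ({additive Hf (target j) -> rat} -> rat : Type).

Definition coordinate_fun (j : task) (v : V) : coordinate_space j :=
  fun x => v (j, existT _ (target j) x).

Arguments coordinate_fun : clear implicits.

Lemma coordinate_zmod_morphism j : zmod_morphism (coordinate_fun j : V -> coordinate_space j).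
Proof. by []. Qed.

Definition coordinate j := projT1 (cid (additiveP (coordinate_zmod_morphism j))).

Lemma coordinateE j v : coordinate j v = coordinate_fun j v.
Proof. exact: (projT2 (cid (additiveP (coordinate_zmod_morphism j)))). Qed.

Lemma coordinate_other i j (h : Hf (target i)) :
  i <> j -> ~ below (level j) (level i) -> coordinate j (generator h) = 0.
Proof.
move=> ij nji; rewrite coordinateE; apply/funext => x.
rewrite /coordinate_fun -[LHS]/(twist _ _ _ h _ + embed_at i h _).
rewrite twist_supported // /embed_at /=.
by case: (pselect (j = i)) => ji; [case: ij | rewrite addr0].
Qed.

(** The new coordinates separate the elements of a Whitehead group. *)
Lemma coordinate_faithful j (h : Hf (target j)) : coordinate j (generator h) = 0 -> h = 0.
Proof.
rewrite coordinateE => h0; apply: contrapT => h_neq0.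
have [x] := Whitehead_separated (@Hf_Whitehead (target j)) h_neq0.
apply; have := congr1 (fun F => F x) h0.
rewrite /coordinate_fun -[LHS]/(twist _ _ _ h _ + embed_at j h _).
rewrite twist_supported; last by move=> jj; exact: (well_founded_asym (@below_wf K) jj jj).
rewrite add0r.
by rewrite /embed_at /=; case: (pselect (j = j)) => // jj; rewrite evaluationE.
Qed.

Lemma tower_monotone a b : below a b -> tower a `<=` tower b.
Proof.
move=> ab; rewrite !towerE; apply: generated_sub => j /= ja.
exact: below_trans ja ab.
Qed.

Lemma task_wf : well_founded (fun i j : task => below (level i) (level j)).
Proof.
move=> j; have [a ja] : exists a, level j = a by exists (level j).
elim/(well_founded_ind (@below_wf K)): a j ja => a IH j ja.
by constructor=> k; rewrite ja => ka; exact: IH ka _ erefl.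
Qed.

Section Union.
Variables (G : zmodType) (i : {additive G -> V}).
Hypothesis i_inj : injective i.
Hypothesis iE : range i = generated generator setT.

Lemma union_Whitehead : Whitehead G.
Proof.
apply: (Whitehead_filtration task_wf (p := coordinate)) i_inj iE => //.
- by move=> j h k; have := generator_mod h k; rewrite towerE.
- exact: coordinate_other.
- exact: coordinate_faithful.
Qed.

Lemma generator_preimage j (h : Hf (target j)) : exists w, i w = generator h.
Proof.
have : range i (generator h) by rewrite iE; apply: mem_generated.
by case=> w _ <-; exists w.
Qed.

(** Of two distinct tasks, one is not below the other, and its coordinate
    vanishes on the generators of the other. *)
Lemma generator_task_inj j k (h : Hf (target j)) (l : Hf (target k)) :
  h <> 0 -> l <> 0 -> generator h = generator l -> j = k.
Proof.
move=> h_neq0 l_neq0 hl; apply: contrapT => jk.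
have [kj|nkj] := pselect (below (level k) (level j)).
  apply: h_neq0; apply: coordinate_faithful; rewrite hl coordinate_other //.
    by move=> kj'; apply: jk.
  exact: well_founded_asym (@below_wf K) kj.
by apply: l_neq0; apply: coordinate_faithful; rewrite -hl coordinate_other.
Qed.

Lemma tree_inj_union : exists w : tree K -> G, injective w.
Proof.
have /choice[w wE] a : exists w : G, exists j (h : Hf (target j)),
    [/\ level j = a, h <> 0 & i w = generator h].
  have [j ja _] := @decode_surj K B Hf a (fun=> 0).
  have [h h_neq0] := Hf_neq0 (target j).
  by have [w wE] := generator_preimage h; exists w, j, h.
exists w => a b ab.
have [j [h [ja h_neq0 hE]]] := wE a; have [k [l [kb l_neq0 lE]]] := wE b.
rewrite -ja -kb; congr level.
by apply: (generator_task_inj h_neq0 l_neq0); rewrite -hE -lE ab.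
Qed.

Hypothesis K_pair : exists k l : K, k <> l.

Lemma union_tower x : generated generator setT x -> exists a, tower a x.
Proof.
have [k0 [l0 kl]] := K_pair.
apply: (@span_min _ _ [set x | exists a, tower a x]).
  split; first by exists leaf; exact: (tower_subgroup _).1.
  move=> y z [a ya] [b zb].
  have [c cP] := below_bound (fun k => if pselect (k = k0) then a else b).
  exists c; apply: (tower_subgroup _).2.
    by apply: tower_monotone ya; have := cP k0; case: pselect.
  apply: tower_monotone zb; have := cP l0; case: pselect => // lk.
  by case: kl.
move=> _ [j [_ [h ->]]]; have [a aP] := below_bound (fun _ : K => level j).
by exists a; rewrite towerE; apply: mem_generated; exact: (aP k0).
Qed.

Hypothesis K_bound : forall f : B -> tree K, exists a, forall b, below (f b) a.

(** All values of f are reached at one stage a. The restriction of f to the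
    tower at a is the function of a task j of level a, and the values of f at
    the generators of j would extend it with values in its range. *)
Lemma union_hom (f : {additive G -> B}) : ~ has_infinite_rank (range f).
Proof.
move=> f_rank.
have /choice[s sP] b : exists a, range f b -> exists w, tower a (i w) /\ f w = b.
  have [[w _ wb]|nb] := pselect (range f b); last by exists leaf.
  have [|a aw] := @union_tower (i w); first by rewrite -iE; exists w.
  by exists a => _; exists w.
have [a aP] := K_bound s.
have /choice[f' f'E] v : exists b, forall w, i w = v -> b = f w.
  have [[w wv]|no] := pselect (exists w, i w = v).
    by exists (f w) => z; rewrite -wv => /i_inj ->.
  by exists 0 => w wv; exfalso; apply: no; exists w.
have [j ja dE] := decode_surj a f'; subst a.
have tower_pre x : tower (level j) x -> exists w, i w = x.
  rewrite towerE => tx; have : range i x by rewrite iE; apply: generated_sub tx.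
  by case=> w _ <-; exists w.
have dw w : tower (level j) (i w) -> decode j (i w) = f w.
  by move=> tw; rewrite dE; [exact: f'E | exact: tower_supported].
have targetE : target j = range f.
  apply/seteqP; split=> [_ [x tx <-]|b fb].
    by have [w wx] := tower_pre _ tx; exists w => //; rewrite -dw wx.
  have [w [tw wb]] := sP b fb.
  have tjw : tower (level j) (i w) by exact: tower_monotone tw.
  by exists (i w) => //; rewrite dw.
have targetI b : range f b -> target j b by rewrite targetE.
have sT := tower_subgroup (level j).
have [_ _ noext] := projT2 (cid (twist_exists (level j) (tower (level j)) (decode j))).
apply: noext => //; first exact: tower_supported.
- move=> x y tx ty; have [w wx] := tower_pre _ tx; have [z zy] := tower_pre _ ty.
  have txy := sT.2 _ _ tx ty.
  by move: tx ty txy; rewrite -wx -zy -raddfB => tx ty txy; rewrite !dw // raddfB.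
- by rewrite -/(target j) targetE.
have /choice[w wE] := @generator_preimage j.
exists (f \o w); split=> [h|h k].
  by apply: targetI; exists (w h).
rewrite -/(twist (level j) (tower (level j)) (decode j)) -generator_defect.
have iw : defect (@generator j) h k = i (defect w h k).
  by rewrite /defect !raddfB !wE.
by rewrite iw dw -?iw; [rewrite /defect !raddfB | exact: generator_mod].
Qed.

End Union.
End Tower.

(** * The theorem *)

(** Diagonalize with a strict upper bound of an enumeration. *)
Lemma tree_uncountable (K : Type) (w : tree (nat + K) -> nat) : ~ injective w.
Proof.
move=> w_inj.
have /choice[s sP] n : exists a, forall b, w b = n -> b = a.
  have [[a an]|no] := pselect (exists a, w a = n).
    by exists a => b bn; apply: w_inj; rewrite an.
  by exists leaf => b bn; exfalso; apply: no; exists b.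
have [a aP] := below_bound (fun k => if k is inl n then s n else leaf).
have := aP (inl (w a)); rewrite -(sP (w a) a erefl) => aa.
exact: (well_founded_asym (@below_wf _) aa aa).
Qed.

Theorem theorem6 :
  GCH ->
  (forall A : zmodType, Whitehead A -> infinite_rank A ->
     exists H : zmodType, [/\ Whitehead H, card_le_succ H A & ~ Ext_eq0 H A]) ->
  forall B : zmodType, Whitehead B ->
    exists G : zmodType, [/\ Whitehead G, ~ countable [set: G] &
      forall f : {additive G -> B}, finitely_generated_set (range f)].
Proof.
move=> _ nonsplit B BW.
have /choice[Hf HfP] (A : set B) : exists H : zmodType,
    [/\ Whitehead H, exists h : H, h <> 0 &
      forall (U : zmodType) (i : {additive U -> B}),
        injective i -> range i = A -> infinite_rank U ->
        exists (U' : zmodType) (i' : {additive U' -> B}),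
          [/\ injective i', range i' = A & ~ Ext_eq0 H U']].
  have [[U [i [i_inj iA iU]]]|no] := pselect (has_infinite_rank A).
    have [H [HW _ nExt]] := nonsplit U (Whitehead_subgroup i_inj BW) iU.
    exists H; split=> //; first exact: nonsplit_neq0 nExt.
    by move=> _ _ _ _ _; exists U, i.
  exists int; split; [exact: Whitehead_int | by exists 1 |].
  by move=> U i i_inj iA iU; exfalso; apply: no; exists U, i.
have HfW A : Whitehead (Hf A) by have [] := HfP A.
have Hf0 A : exists h : Hf A, h <> 0 by have [] := HfP A.
have Hfn A : forall (U : zmodType) (i : {additive U -> B}),
    injective i -> range i = A -> infinite_rank U ->
    exists (U' : zmodType) (i' : {additive U' -> B}),
      [/\ injective i', range i' = A & ~ Ext_eq0 (Hf A) U'] by have [] := HfP A.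
pose K := (nat + B)%type.
have [G [i [i_inj iE]]] := subgroup_as_group
  (span_subgroup _ : subgroup (generated (@generator K B Hf Hfn) setT)).
exists G; split.
- exact: union_Whitehead i_inj iE.
- move=> /countable_injP[g g_inj].
  have [w w_inj] := tree_inj_union HfW Hf0 iE.
  apply: (@tree_uncountable B (g \o w)) => a b /= gab.
  by apply: w_inj; apply: g_inj; rewrite ?inE.
- move=> f.
  have [U [i' [i'_inj i'E]]] := subgroup_as_group (range_subgroup f).
  have [Uinf|Ufin] := pselect (infinite_rank U).
    exfalso; have : has_infinite_rank (range f) by exists U, i'.
    apply: (union_hom i_inj iE).
    + by exists (inl 0%N), (inl 1%N).
    + move=> s; have [a aP] := below_bound (fun k : K => if k is inr b then s b else leaf).
      by exists a => b; exact: (aP (inr b)).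
  have := Whitehead_finite_rank (Whitehead_subgroup i'_inj BW) Ufin.
  by move=> /(finitely_generated_image i'); rewrite i'E.
Qed.
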